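(* Let $h>0$ and let $N\ge 2$ be an integer. Let $\bm{\Omega}_{k,k+1}=(\Omega^1_{k,k+1},\Omega^2_{k,k+1},0)\in\mathbb{R}^3$ and $\bm{\Gamma}_{k+1/2}=(\Gamma^1_{k+1/2},\Gamma^2_{k+1/2},\Gamma^3_{k+1/2})\in\mathbb{R}^3$, $k=0,\dots,N-1$, be sequences satisfying, for every $k=1,\dots,N-1$, the discrete reconstruction equation $$\tfrac1h\big(\bm{\Gamma}_{k+1/2}-\bm{\Gamma}_{k-1/2}\big)=\tfrac12\big(\bm{\Gamma}_{k+1/2}+\bm{\Gamma}_{k-1/2}\big)\times\tfrac12\big(\bm{\Omega}_{k,k+1}+\bm{\Omega}_{k-1,k}\big).$$ Then $\|\bm{\Gamma}_{k+1/2}\|=\|\bm{\Gamma}_{k-1/2}\|$ for every $k=1,\dots,N-1$.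
   Context: Here $\times$ is the cross product on $\mathbb{R}^3$ and $\|\cdot\|$ is the Euclidean norm. The displayed equation is part of the discrete Hamel integrator for the spherical pendulum with time step $h$: it discretizes the equation $\dot{\bm{\Gamma}}=\bm{\Gamma}\times\bm{\Omega}$, where $\bm{\Gamma}$ is the vertical vector and $\bm{\Omega}=(\Omega^1,\Omega^2,0)$ is the angular velocity, both written relative to the body frame. The discrete state is $(\bm{\Gamma}_{k+1/2},\bm{\Omega}_{k,k+1})$; the half-integer and double-integer subscripts are only labels of the sequence elements. *)

(* Defs.v *)
From mathcomp Require Import all_boot all_order all_algebra.
From mathcomp Require Import reals.

Set Implicit Arguments.
Unset Strict Implicit.
Unset Printing Implicit Defensive.

Import Order.TTheory GRing.Theory Num.Theory.

Local Open Scope ring_scope.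

Definition row3 (R : realType) (x y z : R) : 'rV[R]_3 :=
  \row_(i < 3) [:: x; y; z]`_i.

(* The column indices 0, 1, 2 are numerals of the ring 'I_3 (integers mod 3),
   whose values as ordinals are 0, 1, 2. *)
Definition crossmul (R : realType) (u v : 'rV[R]_3) : 'rV[R]_3 :=
  row3 (u 0 1 * v 0 2 - u 0 2 * v 0 1)
       (u 0 2 * v 0 0 - u 0 0 * v 0 2)
       (u 0 0 * v 0 1 - u 0 1 * v 0 0).

(* The norm that the analysis library puts on matrices is the sup norm, so the
   Euclidean norm is defined here. *)
Definition enorm (R : realType) (n : nat) (v : 'rV[R]_n) : R :=
  Num.sqrt (\sum_(i < n) v 0 i ^+ 2).

(* Discrete reconstruction equation at step k >= 1, with time step h.
   [Gamma k] stands for Gamma_{k+1/2} and [Omega k] for Omega_{k,k+1}. *)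
Definition reconstruction_eq (R : realType) (h : R)
    (Gamma Omega : nat -> 'rV[R]_3) (k : nat) : Prop :=
  h^-1 *: (Gamma k - Gamma k.-1) =
  crossmul (2^-1 *: (Gamma k + Gamma k.-1)) (2^-1 *: (Omega k + Omega k.-1)).

(* Main.v *)
Require Import Defs.
From mathcomp Require Import all_boot all_order all_algebra.
From mathcomp Require Import reals.
From mathcomp Require Import ring.

Set Implicit Arguments.
Unset Strict Implicit.
Unset Printing Implicit Defensive.

Import Order.TTheory GRing.Theory Num.Theory.

Local Open Scope ring_scope.

(** Pairing the equation with the midpoint (Gamma_{k+1/2} + Gamma_{k-1/2})/2
    kills the right-hand side, since a cross product is orthogonal to its first
    factor; the left-hand side becomes
    (|Gamma_{k+1/2}|^2 - |Gamma_{k-1/2}|^2) / (2h). *)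

Lemma crossmul_orthol (R : realType) (u v : 'rV[R]_3) :
  \sum_(i < 3) u 0 i * crossmul u v 0 i = 0.
Proof.
(* [big_ord_recl] yields lifts of [ord0]; matching them with the numerals in [crossmul] lets [ring]
   see equal entries as one atom. *)
have e1 : lift ord0 ord0 = 1 :> 'I_3 by exact: val_inj.
have e2 : lift ord0 (lift ord0 ord0) = 2 :> 'I_3 by exact: val_inj.
rewrite !big_ord_recl big_ord0 !mxE /= e1 e2.
by ring.
Qed.

(** Termwise (a + b)(a - b) = a^2 - b^2, so the sum is the difference of the two squared norms. *)
Lemma eq_enorm_orthogonal (R : realType) (n : nat) (u v : 'rV[R]_n) :
  \sum_(i < n) (u + v) 0 i * (u - v) 0 i = 0 -> enorm u = enorm v.
Proof.
move=> uv0; congr Num.sqrt; apply/subr0_eq; rewrite -sumrB -[RHS]uv0.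
by apply: eq_bigr => i _; rewrite !mxE subr_sqr mulrC.
Qed.

Theorem mainTheorem1 (R : realType) (h : R) (N : nat)
    (Omega1 Omega2 : nat -> R) (Omega Gamma : nat -> 'rV[R]_3)
    (h_gt0 : 0 < h) (N_ge2 : (2 <= N)%N)
    (OmegaE : forall k, (k < N)%N -> Omega k = row3 (Omega1 k) (Omega2 k) 0)
    (Gamma_rec : forall k, (1 <= k < N)%N -> reconstruction_eq h Gamma Omega k) :
  forall k, (1 <= k < N)%N -> enorm (Gamma k) = enorm (Gamma k.-1).
Proof.
move=> k /Gamma_rec rec_k; apply: eq_enorm_orthogonal.
(* [2^-1] comes from the midpoint, [h^-1] from the difference quotient; scaling by their product
   makes the goal the pairing of these two vectors. *)
have c_neq0 : 2^-1 * h^-1 != 0 :> R.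
  by rewrite mulf_neq0 // invr_eq0 ?pnatr_eq0 ?gt_eqF.
apply: (mulfI c_neq0); rewrite mulr0 mulr_sumr.
rewrite -[RHS](crossmul_orthol (2^-1 *: (Gamma k + Gamma k.-1))
                               (2^-1 *: (Omega k + Omega k.-1))) -rec_k.
by apply: eq_bigr => i _; rewrite [in RHS]mxE [X in _ = _ * X]mxE mulrACA.
Qed.
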